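(* For all real numbers $\xi>0$ and $\alpha_1,\alpha_2>0$ there exists $n_0$ such that for every integer $n\ge n_0$ the following holds: if $N$ is an integer with $N\ge(\alpha_1+\alpha_2+8\xi)n$, then every $2$-edge coloring (with colors $1,2$) of the complete bipartite graph $K_{N,N}$ contains a monochromatic copy of $C_{2\lfloor\alpha_1 n\rfloor}$ in color $1$ or a monochromatic copy of $C_{2\lfloor\alpha_2 n\rfloor}$ in color $2$.
   Context: $C_m$ denotes the cycle of length $m$. A $2$-edge coloring of a graph is an arbitrary assignment of one of the colors $1,2$ to each edge. Copies are (not necessarily induced) subgraphs. *)

(* Defs.v *)
From HB Require Import structures.
From mathcomp Require Import all_boot all_order all_algebra.
From mathcomp Require Import reals.

Set Implicit Arguments.
Unset Strict Implicit.
Unset Printing Implicit Defensive.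

Record sgraph := SGraph {
  vertex :> finType;
  adj : rel vertex;
  adj_sym : symmetric adj;
  adj_irrefl : irreflexive adj }.

Definition is_edge (G : sgraph) (e : {set G}) : bool :=
  [exists x : G, exists y : G, adj x y && (e == [set x; y])].

Definition edge (G : sgraph) : Type := {e : {set G} | is_edge e}.

Definition cycle_adj (m : nat) : rel 'I_m :=
  fun i j => (i != j) && ((j == ordS i) || (i == ordS j)).

Lemma cycle_adj_sym m : symmetric (@cycle_adj m).
Proof. by move=> i j; rewrite /cycle_adj eq_sym orbC. Qed.

Lemma cycle_adj_irrefl m : irreflexive (@cycle_adj m).
Proof. by move=> i; rewrite /cycle_adj eqxx. Qed.

(* ordS is the successor modulo m, so this is the usual cycle for m >= 3; for
   m < 3 it is the degenerate graph K_m. *)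
Definition cycle_graph (m : nat) : sgraph :=
  SGraph (@cycle_adj_sym m) (@cycle_adj_irrefl m).

Definition Kbip_adj (a b : nat) : rel ('I_a + 'I_b)%type :=
  fun x y => match x, y with
             | inl _, inr _ | inr _, inl _ => true
             | _, _ => false
             end.

Lemma Kbip_adj_sym a b : symmetric (@Kbip_adj a b).
Proof. by move=> [x|x] [y|y]. Qed.

Lemma Kbip_adj_irrefl a b : irreflexive (@Kbip_adj a b).
Proof. by move=> [x|x]. Qed.

Definition Kbip (a b : nat) : sgraph :=
  SGraph (@Kbip_adj_sym a b) (@Kbip_adj_irrefl a b).

Inductive color := color1 | color2.

Definition edge_coloring (G : sgraph) : Type := edge G -> color.

(* A not necessarily induced copy of H in G, all of whose edges have color k:
   an injection of the vertices of H mapping each edge of H to an edge of G of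
   color k. *)
Definition mono_copy (G : sgraph) (c : edge_coloring G) (k : color)
    (H : sgraph) : Prop :=
  exists f : H -> G, injective f /\
    forall x y : H, adj x y ->
      exists e : edge G, val e = [set f x; f y] /\ c e = k.

(* Main.v *)
Require Import Defs.
From HB Require Import structures.
From mathcomp Require Import all_boot all_order all_algebra.
From mathcomp Require Import reals.
From mathcomp Require Import boolp zify lra.

Set Implicit Arguments.
Unset Strict Implicit.
Unset Printing Implicit Defensive.

(* No regularity lemma is needed. Greedily remove disjoint red bicliques K_{t,t}
   ("bricks", t a large constant). If the packing stops after covering fewer than
   about a vertices per side, then almost every remaining vertex of X is blue to
   almost all of the remaining, still more than b, vertices of Y, and a blue
   C_{2b} is built greedily. If it does not stop and red is robustly connected,
   string the bricks on a red cycle by short connecting paths; these use few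
   vertices, so inserting unused pairs of a brick at an edge of the cycle inside
   that brick lengthens the cycle by 2 at a time up to exactly 2a.
   Exchanging colors, it remains to treat the case that neither color is robustly
   connected. A failure of connectivity gives, off few vertices, a cut that no
   edge of that color crosses. A red and a blue cut together force either all of
   X on one side of both cuts, and then some vertices of Y are red to all of X,
   making red robustly connected, or a 2 x 2 pattern of complete monochromatic
   blocks, one of which is large enough. *)

(** * Walks and bricks *)

Section Walks.
Variables (X Y : finType).
Implicit Types (r : X -> Y -> bool) (u v x : X) (y : Y) (s : seq (Y * X)).

(* A step (y, x) of a walk goes from the current vertex to y and then to x. *)
Fixpoint walk r u s : bool :=
  if s is (y, x) :: s' then [&& r u y, r x y & walk r x s'] else true.

(** A cycle of length 2m for m >= 2, a single edge traversed twice for m = 1. The start [u] recurs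
    as the last vertex, so on the side of X distinctness is asked of [unzip2 s] only. *)
Definition acycle r (m : nat) : Prop :=
  exists u s, [/\ walk r u s, last u (unzip2 s) = u, uniq (unzip1 s),
                  uniq (unzip2 s) & size s = m].

Definition rdeg r x : nat := #|[set y | r x y]|.

Lemma walk_cat r u s1 s2 :
  walk r u (s1 ++ s2) = walk r u s1 && walk r (last u (unzip2 s1)) s2.
Proof. by elim: s1 u => [|[y x] s1 IH] u //=; rewrite IH -!andbA. Qed.

Lemma subset_of_card (T : finType) (A : {set T}) n :
  n <= #|A| -> exists2 B : {set T}, B \subset A & #|B| = n.
Proof.
move=> nA; exists [set x in take n (enum A)].
  by apply/subsetP=> x; rewrite inE => /mem_take; rewrite mem_enum.
rewrite cardsE (card_uniqP _) ?take_uniq ?enum_uniq // size_take -cardE.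
by case: ltnP => //; lia.
Qed.

Lemma fresh_elt (T : finType) (A : {set T}) (F : seq T) :
  size F < #|A| -> exists2 x, x \in A & x \notin F.
Proof.
move=> FA; have /subsetPn[x xA xF] : ~~ (A \subset F).
  apply: contraTN FA => /subset_leq_card; rewrite -leqNgt => /leq_trans; apply.
  exact: card_size.
by exists x.
Qed.

(** Greedy choice: each step takes a common neighbour outside [F], which collects the vertices of Y
    already used. *)
Lemma walk_through r (A : {set X}) m u (xs : seq X) (F : seq Y) :
  (forall x x', x \in A -> x' \in A -> m <= #|[set y | r x y && r x' y]|) ->
  u \in A -> {subset xs <= A} -> size F + size xs <= m ->
  exists s, [/\ walk r u s, unzip2 s = xs, uniq (unzip1 s)
             & {in unzip1 s, forall y, y \notin F}].
Proof.
move=> rich; elim: xs u F => [|x xs IH] u F uA xsA /= sz.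
  by exists [::]; split.
have xA : x \in A by apply: xsA; rewrite mem_head.
have [|y] := @fresh_elt _ [set y | r u y && r x y] F.
  by apply: leq_trans (rich _ _ uA xA); lia.
rewrite inE => /andP[ruy rxy] yF.
have [||s [ws <- us sF]] := IH x (y :: F) xA.
- by move=> z zs; apply: xsA; rewrite inE zs orbT.
- by rewrite /=; lia.
exists ((y, x) :: s); split => //=; first by rewrite ruy rxy.
- rewrite us andbT; apply/negP => /sF; by rewrite mem_head.
- move=> z; rewrite inE => /predU1P[->//|/sF].
  by rewrite inE negb_or => /andP[].
Qed.

(** A walk through an enumeration of [m] vertices of [A] closes up if it starts at the last of
    them. *)
Lemma rich_acycle r (A : {set X}) m : 0 < m -> m <= #|A| ->
  (forall x x', x \in A -> x' \in A -> m <= #|[set y | r x y && r x' y]|) ->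
  acycle r m.
Proof.
move=> m0 mA rich.
have [B BA Bm] := subset_of_card mA.
have sB : size (enum B) = m by rewrite -cardE.
have [x0 _] : exists x0, x0 \in B by apply/card_gt0P; rewrite Bm.
have BA' : {subset enum B <= A}.
  by move=> z; rewrite mem_enum => /(subsetP BA).
have lB : last x0 (enum B) \in enum B.
  by case: (enum B) sB => [|z l]; [move=> /= zm; rewrite -zm in m0|rewrite /= mem_last].
have [|s [ws sE us _]] := @walk_through r A m _ (enum B) [::] rich (BA' _ lB) BA'.
  by rewrite /= sB.
exists (last x0 (enum B)), s; split => //; rewrite ?sE //.
- by case: (enum B) sB => [|z l] //= zm; rewrite -zm in m0.
- exact: enum_uniq.
- by rewrite -sB -sE size_map.
Qed.

(** Pigeonhole on the traces [T y] of vertices y on [A]. If no [t] vertices share a trace of size at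
    least [t], at most t 2^|A| vertices have so large a trace; counting the edges between [A] and
    [B] from both sides then contradicts the degrees. *)
Lemma brick_exists r (A : {set X}) (B : {set Y}) t D :
  t * #|B| + #|A| * (t * 2 ^ #|A|) < #|A| * D ->
  (forall x, x \in A -> D <= #|[set y in B | r x y]|) ->
  exists (P : {set X}) (Q : {set Y}), [/\ P \subset A, Q \subset B, #|P| = t,
    #|Q| = t & forall x y, x \in P -> y \in Q -> r x y].
Proof.
move=> num dA.
pose T y := [set x in A | r x y].
pose B' := [set y in B | t <= #|T y|].
have TA y : T y \in powerset A.
  by rewrite inE; apply/subsetP => x; rewrite inE => /andP[].
(* The positivity conjunct supplies [y0] also when t = 0. *)
case: (boolP [exists S : {set X},
    (0 < #|[set y in B' | T y == S]|) && (t <= #|[set y in B' | T y == S]|)]).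
  case/existsP => S /andP[/card_gt0P[y0]]; rewrite inE => /andP[y0B /eqP y0S] tS.
  have [Q QS Qt] := subset_of_card tS.
  have tS' : t <= #|S| by move: y0B; rewrite inE y0S => /andP[].
  have [P PS Pt] := subset_of_card tS'.
  exists P, Q; split => //.
  - apply: subset_trans PS _; move: (TA y0); by rewrite y0S inE.
  - apply: subset_trans QS _; apply/subsetP => y.
    by rewrite !inE => /andP[/andP[]].
  - move=> x y /(subsetP PS) xS /(subsetP QS); rewrite inE => /andP[_ /eqP yS].
    by move: xS; rewrite -yS inE => /andP[].
rewrite negb_exists => /forallP noS; exfalso.
have cardB' : #|B'| <= t * 2 ^ #|A|.
  rewrite -card_powerset -sum1_card.
  rewrite (partition_big T (fun S => S \in powerset A)) //=.
  rewrite mulnC -sum_nat_const; apply: leq_sum => S _.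
  have := noS S; rewrite negb_and -!leqNgt -ltnNge => H.
  rewrite (eq_bigl (mem [set y in B' | T y == S])) ?sum1_card; last first.
    by move=> y; rewrite !inE.
  lia.
have : #|A| * D <= \sum_(x in A) #|[set y in B | r x y]|.
  by rewrite -sum_nat_const; apply: leq_sum.
have -> : \sum_(x in A) #|[set y in B | r x y]| = \sum_(y in B) #|T y|.
  transitivity (\sum_(x in A) \sum_(y in B) (r x y : nat)).
    apply: eq_bigr => x _; rewrite -sum1dep_card big_mkcondr.
    by apply: eq_bigr => y _; case: (r x y).
  rewrite exchange_big; apply: eq_bigr => y _; rewrite -sum1dep_card big_mkcondr.
  by apply: eq_bigr => x _; case: (r x y).
apply/negP; rewrite -ltnNge; apply: leq_ltn_trans num.
rewrite (bigID (fun y => t <= #|T y|)) /= addnC; apply: leq_add.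
  rewrite mulnC -sum_nat_const big_mkcondr /=; apply: leq_sum => y _.
  by case: (leqP t #|T y|) => //= /ltnW.
apply: (@leq_trans (#|B'| * #|A|)); last by rewrite mulnC leq_mul2l cardB' orbT.
rewrite -sum_nat_const (eq_bigl (mem B')); last by move=> y; rewrite !inE.
apply: leq_sum => y _; apply: subset_leq_card.
by have := TA y; rewrite inE.
Qed.

End Walks.

(** * Robust connectivity *)

Lemma count_split (T : Type) (a : pred T) n (s : seq T) : n < count a s ->
  exists s1 z s2, [/\ s = s1 ++ z :: s2, a z & n <= count a s2].
Proof.
elim: s => // z s IH /=; case az: (a z).
  by rewrite add1n ltnS => ?; exists [::], z, s.
rewrite add0n => /IH [s1 [z' [s2 [-> az' ns2]]]].
by exists (z :: s1), z', s2.
Qed.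

Lemma not_uniq_split (S T : eqType) (f : S -> T) (s : seq S) :
  ~~ uniq (map f s) ->
  exists s1 z1 s2 z2 s3, s = s1 ++ z1 :: s2 ++ z2 :: s3 /\ f z1 = f z2.
Proof.
elim: s => // z s IH /=; rewrite negb_and negbK => /orP[|/IH].
  case/mapP => z' /splitPr[s1 s2] zz'.
  by exists [::], z, s1, z', s2.
by case=> s1 [z1 [s2 [z2 [s3 [-> E]]]]]; exists (z :: s1), z1, s2, z2, s3.
Qed.

Section Linked.
Variables (X Y : finType).
Implicit Types (r : X -> Y -> bool) (u v x : X) (y : Y) (s : seq (Y * X)).

(** Robust connectivity: deleting [w] vertices on each side leaves a short path between any two
    remaining vertices of [X0] of large degree. Its inner vertices may lie outside [X0]. *)
Definition linked r (X0 : {set X}) (d w L : nat) : Prop :=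
  forall (WX : {set X}) (WY : {set Y}) u v, #|WX| <= w -> #|WY| <= w ->
    u \in X0 :\: WX -> v \in X0 :\: WX -> u != v ->
    2 * d <= rdeg r u -> 2 * d <= rdeg r v ->
  exists s, [/\ walk r u s, last u (unzip2 s) = v, uniq (unzip1 s),
     uniq (u :: unzip2 s) & [/\ {in unzip2 s, forall x, x \notin WX},
     {in unzip1 s, forall y, y \notin WY} & size s <= L]].

(** [sigma] and [tau] name the side of the cut on which a vertex lies. The last clause gives each
    side at least 2d - w vertices of Y outside [WY]. *)
Definition cut r (d w : nat) : Prop :=
  exists (WX : {set X}) (WY : {set Y}) (sigma : X -> bool) (tau : Y -> bool),
  [/\ #|WX| <= w, #|WY| <= w,
      forall x y, x \notin WX -> d <= rdeg r x -> y \notin WY -> r x y ->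
        sigma x = tau y
    & forall c, 2 * d <= #|[set y | tau y == c] :\: WY| + w].

(** * Shortest walks through vertices of large degree *)

Section MinimalWalk.
Variables (r : X -> Y -> bool) (WX : {set X}) (WY : {set Y}) (d : nat).
Let adm (z : Y * X) := [&& z.1 \notin WY, z.2 \notin WX & d <= rdeg r z.2].
Let ok u v s := [&& walk r u s, last u (unzip2 s) == v & all adm s].

Lemma ex_minimal_walk u v s0 : ok u v s0 ->
  exists2 s, ok u v s & forall s', ok u v s' -> size s <= size s'.
Proof.
move=> ok0.
pose P n := [exists t : n.-tuple (Y * X), ok u v t].
have exP : exists n, P n.
  by exists (size s0); apply/existsP; exists (in_tuple s0).
case: (ex_minnP exP) => n /existsP[t okt] mint.
exists (tval t) => // s' oks'; rewrite size_tuple; apply: mint.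
by apply/existsP; exists (in_tuple s').
Qed.

(** A repeated vertex would allow a shortcut. For the length, pairs of a step and a neighbour of its
    X-vertex outside [WY] are counted twice: each step has at least d - |WY| of them, and each y
    occurs in at most two. *)
Lemma minimal_walkP u v s : ok u v s ->
  (forall s', ok u v s' -> size s <= size s') ->
  [/\ uniq (unzip1 s), uniq (u :: unzip2 s) &
      size s * (d - #|WY|) <= 2 * #|Y|].
Proof.
move=> oks mins; split.
- apply: contraT => /not_uniq_split [s1 [z1 [s2 [z2 [s3 [Es E]]]]]].
  suff /mins : ok u v (s1 ++ z2 :: s3) by rewrite Es !size_cat /= size_cat /=; lia.
  move: oks E; rewrite Es /ok {Es mins} /unzip2 !map_cat !last_cat !all_cat /=.
  case: z1 z2 => [y1 x1] [y2 x2] /=; rewrite map_cat last_cat all_cat !walk_cat /=.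
  rewrite !walk_cat /= => /and3P[/and5P[-> r1 _ _ /and3P[_ r2 ->]] -> /and4P[-> _ _ /andP[-> ->]]] E.
  by rewrite -E r1 E r2.
- apply: contraT; rewrite /= negb_and negbK => /orP[|].
    case/mapP => [[y x]] /splitPr Es /= ux.
    case: Es oks mins => s1 s2 oks mins.
    suff /mins : ok u v s2 by rewrite size_cat /=; lia.
    move: oks; rewrite /ok /unzip2 !map_cat !last_cat !all_cat walk_cat /= -ux.
    by case/and3P => /and4P[_ _ _ ->] -> /and3P[_ _ ->].
  case/not_uniq_split => [s1 [[y1 x1] [s2 [[y2 x2] [s3 [Es /= E]]]]]].
  suff /mins : ok u v (s1 ++ (y1, x1) :: s3).
    by rewrite Es !size_cat /= size_cat /=; lia.
  move: oks; rewrite Es /ok {Es mins} /unzip2 !map_cat !last_cat !all_cat /=.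
  rewrite map_cat last_cat all_cat !walk_cat /= !walk_cat /= -E.
  by case/and3P => [/and5P[-> -> -> _ /and3P[_ _ ->]] -> /and4P[-> -> _ /andP[_ ->]]].
(* Going through y between two non-consecutive vertices would be a shortcut. *)
have two y : y \notin WY -> count (fun z => r z.2 y) s <= 2.
  move=> yW; rewrite leqNgt; apply/negP => /count_split[s1 [z1 [t1 [E1 r1]]]].
  case/count_split => [s2 [z2 [t2 [E2 r2]]]].
  case/count_split => [s3 [z3 [t3 [E3 r3 _]]]].
  suff /mins : ok u v (s1 ++ z1 :: (y, z3.2) :: t3).
    by rewrite E1 E2 E3 !size_cat /= !size_cat /= !size_cat /=; lia.
  move: oks; rewrite E1 E2 E3 /ok {E1 E2 E3 mins} /unzip2 !map_cat /= !map_cat /= !map_cat.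
  rewrite !last_cat !all_cat /= !last_cat !all_cat /= !last_cat !all_cat /= /adm yW.
  case: z1 z2 z3 r1 r2 r3 => [y1 x1] [y2 x2] [y3 x3] /= r1 r2 r3.
  rewrite !walk_cat /= !walk_cat /= !walk_cat /= r1 r3.
  case/and3P => /and5P[-> -> -> _ /and5P[_ _ _ _ /andP[_ ->]]] ->.
  by case/and5P => -> -> _ _ /and3P[_ /and3P[_ -> ->] ->].
apply: (@leq_trans (\sum_(z <- s) \sum_(y | y \notin WY) (r z.2 y : nat))).
  have /and3P[_ _ /allP sadm] := oks.
  rewrite -[size s]sum1_size big_distrl /= [leqLHS]big_seq [leqRHS]big_seq; apply: leq_sum => z /sadm.
  case/and3P => _ _ dz; rewrite mul1n.
  apply: leq_trans (leq_sub2r _ dz) _; rewrite leq_subLR addnC.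
  apply: (@leq_trans #|[set y | r z.2 y] :\: WY :|: WY|).
    by apply: subset_leq_card; apply/subsetP => y; rewrite !inE => ->; case: (y \in WY).
  apply: leq_trans (leq_card_setU _ _) _; rewrite leq_add2r -sum1_card.
  rewrite big_mkcond [leqRHS]big_mkcond; apply: leq_sum => y _.
  by rewrite !inE; case: (y \in WY) => //=; case: (r z.2 y).
rewrite exchange_big /= mulnC -sum_nat_const big_mkcond; apply: leq_sum => y _.
case: ifP => // yW; apply: leq_trans (two y yW).
by rewrite -sum1_count [leqRHS]big_mkcond; apply: leq_sum => z _; case: (r z.2 y).
Qed.

End MinimalWalk.

(** If [v] cannot be reached from [u] after some deletion, the component of [u] defines a cut;
    otherwise a shortest walk has at most [L] steps. *)
Lemma linked_or_cut r d w L : 2 * #|Y| < L.+1 * (d - w) ->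
  cut r d w \/ linked r [set: X] d w L.
Proof.
move=> num; have [|nocut] := pselect (cut r d w); first by left.
right=> WX WY u v WXw WYw; rewrite !inE !andbT => uW vW uv du dv.
(* Only the vertex being entered is constrained, so [connect e u] is reachability through admissible
   vertices. *)
pose e := [rel x x' | [&& x' \notin WX, d <= rdeg r x' &
                      [exists y, [&& y \notin WY, r x y & r x' y]]]].
have [/connectP[p ep pv]|nuv] := boolP (connect e u v); last first.
  case: nocut; exists WX, WY, (connect e u).
  exists (fun y => [exists x, connect e u x && r x y]); split => //.
    move=> x y xW dx yW rxy; apply/idP/existsP => [ux|[x' /andP[ux' rx'y]]].
      by exists x; rewrite ux.
    apply: connect_trans ux' (connect1 _); rewrite /= xW dx.
    by apply/existsP; exists y; rewrite yW rxy rx'y.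
  (* Outside [WY], all neighbours of [u] lie on one side and all neighbours of [v] on the other;
     this makes both sides large. *)
  have key x c : 2 * d <= rdeg r x ->
      (forall y, y \notin WY -> r x y -> [exists x, connect e u x && r x y] = c) ->
      2 * d <= #|[set y | [exists x, connect e u x && r x y] == c] :\: WY| + w.
    move=> dx H; apply: leq_trans dx _; apply: leq_trans (leq_add (leqnn _) WYw).
    apply: leq_trans (leq_card_setU _ _); apply: subset_leq_card.
    apply/subsetP => y; rewrite !inE => rxy.
    by case: (boolP (y \in WY)) => //= yW; rewrite (H y yW rxy) eqxx.
  case; first by apply: (key u) => // y yW ruy; apply/existsP; exists u; rewrite connect0.
  apply: (key v) => // y yW rvy; apply: contraNF nuv => /existsP[x /andP[ux rxy]].
  apply: connect_trans ux (connect1 _); rewrite /= vW.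
  have -> : d <= rdeg r v by lia.
  by apply/existsP; exists y; rewrite yW rvy rxy.
pose adm (z : Y * X) := [&& z.1 \notin WY, z.2 \notin WX & d <= rdeg r z.2].
have [s0 ok0] : exists s, [&& walk r u s, last u (unzip2 s) == v & all adm s].
  rewrite pv {pv uv uW du}; elim: p u ep => [|x p IH] u /=.
    by exists [::]; rewrite /= eqxx.
  case/andP => /and3P[xW dx /existsP[y /and3P[yW ruy rxy]]] /IH[s /and3P[ws /eqP ls adms]].
  exists ((y, x) :: s) => /=; rewrite ruy rxy ws ls eqxx adms.
  by rewrite /adm /= xW dx yW.
have [s oks mins] := ex_minimal_walk ok0.
have [u1 u2 sz] := minimal_walkP oks mins.
case/and3P: oks => ws /eqP ls /allP adms.
exists s; split => //; split.
- by move=> x /mapP[z /adms /and3P[_ zW _] ->].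
- by move=> y /mapP[z /adms /and3P[zW _ _] ->].
rewrite leqNgt; apply/negP => Ls; move: (leq_trans num (leq_mul Ls (leqnn _))).
by apply/negP; rewrite -leqNgt; apply: leq_trans sz; rewrite leq_mul2l leq_sub2l ?orbT.
Qed.

End Linked.

(** * Growing a cycle through a brick packing *)

Lemma uniq_insert (T : eqType) (s1 s2 : seq T) x :
  uniq (s1 ++ x :: s2) = (x \notin s1 ++ s2) && uniq (s1 ++ s2).
Proof. by rewrite -[x :: s2]cat1s uniq_catCA. Qed.

Section Bricks.
Variables (X Y : finType) (r : X -> Y -> bool).

(** Indexing by all naturals lets a packing of [k] bricks be extended by overriding the value at
    [k]. *)
Definition packing (A : {set X}) (t k : nat) (P : nat -> {set X})
    (Q : nat -> {set Y}) : Prop :=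
  (forall i, i < k -> [/\ #|P i| = t, #|Q i| = t, P i \subset A
     & forall x y, x \in P i -> y \in Q i -> r x y]) /\
  (forall i j, i < k -> j < k -> i != j ->
     [disjoint P i & P j] /\ [disjoint Q i & Q j]).

Lemma packing_or_acycle (X0 : {set X}) t k sz D b :
  0 < b ->
  t * #|Y| + sz * (t * 2 ^ sz) < sz * D ->
  k * t + sz + b <= #|X0| -> k * t + 2 * D + b <= #|Y| ->
  acycle (fun x y => ~~ r x y) b \/
  exists P Q, packing [set x in X0 | D <= rdeg r x] t k P Q.
Proof.
move=> b0 num HX HY.
suff: forall j, j <= k -> acycle (fun x y => ~~ r x y) b \/
  exists P Q, packing [set x in X0 | D <= rdeg r x] t j P Q by apply.
elim=> [|j IH] jk.
  by right; exists (fun=> set0), (fun=> set0); split.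
have [|[P [Q [HP disj]]]] := IH (ltnW jk); first by left.
pose X1 := X0 :\: \bigcup_(i < j) P i.
pose Y1 := ~: \bigcup_(i < j) Q i.
have jt : j * t <= k * t by rewrite leq_mul2r (ltnW jk) orbT.
have cup (T : finType) (F : nat -> {set T}) : (forall i, i < j -> #|F i| = t) ->
    #|\bigcup_(i < j) F i| <= j * t.
  move=> Ft; rewrite -[j in j * t]card_ord -sum_nat_const.
  elim/big_rec2: _ => [|i m A _ IHA]; first by rewrite cards0.
  by apply: leq_trans (leq_card_setU _ _) _; rewrite Ft // leq_add2l.
have X1c : sz + b <= #|X1|.
  have := cup _ P (fun i ij => let: And4 e _ _ _ := HP i ij in e).
  have := cardsD X0 (\bigcup_(i < j) P i).
  have := subset_leq_card (subsetIr X0 (\bigcup_(i < j) P i)).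
  rewrite -/X1; lia.
have Y1c : 2 * D + b <= #|Y1|.
  have := cup _ Q (fun i ij => let: And4 _ e _ _ := HP i ij in e).
  have := cardsC (\bigcup_(i < j) Q i); rewrite -/Y1; lia.
pose A := [set x in X1 | D <= #|[set y in Y1 | r x y]|].
have [szA|Asz] := leqP sz #|A|; last first.
  left; apply: (@rich_acycle _ _ _ (X1 :\: A)) => //.
    have := cardsD X1 A; have := subset_leq_card (subsetIr X1 A); lia.
  move=> x x'; rewrite !inE => /andP[+ xX1] /andP[+ x'X1].
  rewrite xX1 x'X1 /= -!ltnNge => xD x'D.
  have : #|Y1| <= #|[set y in Y1 | r x y] :|: [set y in Y1 | r x' y]
             :|: [set y | ~~ r x y && ~~ r x' y]|.
    apply: subset_leq_card; apply/subsetP => y; rewrite !inE => ->.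
    by case: (r x y); case: (r x' y).
  move=> /leq_trans => /(_ _ (leq_card_setU _ _)).
  have [+ _] := leq_card_setU [set y in Y1 | r x y] [set y in Y1 | r x' y]; lia.
right.
(* Exactly [sz] vertices are kept, because the bound in [brick_exists] is exponential in their
   number. *)
have [A' A'A A'sz] := subset_of_card szA.
have [||P' [Q' [PA QY Pt Qt PQ]]] := @brick_exists _ _ r A' Y1 t D.
- rewrite A'sz; apply: leq_ltn_trans num; rewrite leq_add2r leq_mul2l.
  by rewrite max_card orbT.
- by move=> x /(subsetP A'A); rewrite inE => /andP[].
exists (fun i => if i == j then P' else P i), (fun i => if i == j then Q' else Q i).
have PX1 : P' \subset X1.
  apply: subset_trans PA (subset_trans A'A _); apply/subsetP => x.
  by rewrite inE => /andP[].
have djP i : i < j -> [disjoint P i & P'].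
  move=> ij; rewrite disjoint_sym disjoint_subset; apply/subsetP => x /(subsetP PX1).
  rewrite !inE => /andP[+ _]; apply: contraNN => xP.
  by apply/bigcupP; exists (Ordinal ij).
have djQ i : i < j -> [disjoint Q i & Q'].
  move=> ij; rewrite disjoint_sym disjoint_subset; apply/subsetP => y /(subsetP QY).
  rewrite !inE; apply: contraNN => yQ.
  by apply/bigcupP; exists (Ordinal ij).
split.
  move=> i; rewrite ltnS leq_eqVlt; case: eqP => [_ _|_ /= ij]; last exact: HP.
  split => //; apply: subset_trans PA (subset_trans A'A _).
  apply/subsetP => x; rewrite !inE => /andP[/andP[_ ->]] /=.
  move/leq_trans; apply; apply: subset_leq_card; apply/subsetP => y.
  by rewrite !inE => /andP[].
move=> i i'; rewrite !ltnS !(leq_eqVlt i) !(leq_eqVlt i').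
case: (eqVneq i j) => [->|ij]; case: (eqVneq i' j) => [->|i'j] //=.
- by move=> _ lt _; have [d1 d2] := (djP _ lt, djQ _ lt); rewrite disjoint_sym d1 disjoint_sym d2.
- by move=> lt _ _; rewrite djP // djQ.
- exact: disj.
Qed.

Lemma sum_count_disjoint (T : finType) (P : nat -> {set T}) k (s : seq T) :
  (forall i j, i < k -> j < k -> i != j -> [disjoint P i & P j]) ->
  \sum_(i < k) count (mem (P i)) s <= size s.
Proof.
move=> dj; elim: s => [|x s IH] /=; first by rewrite big1.
rewrite big_split /= -add1n leq_add //.
case: (pickP (fun i : 'I_k => x \in P i)) => [i0 xi0|no]; last first.
  by rewrite big1 // => i _; rewrite no.
rewrite (bigD1 i0) //= big1 ?addn0 ?leq_b1 // => i ii0.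
have := dj i i0 (ltn_ord _) (ltn_ord _) ii0.
rewrite disjoint_sym disjoint_subset => /subsetP/(_ x xi0).
by rewrite !inE => /negbTE ->.
Qed.

Lemma count_lt_fresh (T : finType) (P : {set T}) (s : seq T) :
  count (mem P) s < #|P| -> exists2 x, x \in P & x \notin s.
Proof.
move=> lt; have [x xP] : exists2 x, x \in P & x \notin filter (mem P) s.
  by apply: fresh_elt; rewrite size_filter.
by rewrite mem_filter /= xP => ?; exists x.
Qed.

(* Inserting an unused pair of a brick at an edge of the cycle inside that brick
   lengthens the cycle by 2; the slack c bounds the imbalance caused by the
   connecting paths. *)
Lemma grow_cycle A t k P Q (c : nat -> nat) h a : packing A t k P Q ->
  \sum_(i < k) c i <= h -> a + h <= k * t ->
  forall u s, size s <= a -> walk r u s -> last u (unzip2 s) = u ->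
    uniq (unzip1 s) -> uniq (unzip2 s) ->
    (forall i, i < k -> exists2 z, z \in s & (z.1 \in Q i) && (z.2 \in P i)) ->
    (forall i, i < k -> count (mem (Q i)) (unzip1 s)
                        <= count (mem (P i)) (unzip2 s) + c i) ->
  acycle r a.
Proof.
move=> [HP disj] ch ahk u s.
have [n] := ubnP (a - size s); elim: n s => // n IH s lt sa ws lu u1 u2 gate bal.
have [sa'|as'] := ltnP (size s) a; last first.
  by exists u, s; split => //; apply/eqP; rewrite eqn_leq sa.
case: (pickP (fun i : 'I_k => (count (mem (P i)) (unzip2 s) < t) &&
                          (count (mem (Q i)) (unzip1 s) < t))); last first.
  move=> full; exfalso.
  (* With no room in any brick, the balance puts at least t - c i vertices of each [P i] on the
     cycle, so k t <= size s + h < a + h. *)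
  have : k * t <= \sum_(i < k) (count (mem (P i)) (unzip2 s) + c i).
    rewrite -[k in k * t]card_ord -sum_nat_const; apply: leq_sum => i _.
    have := full i; have := bal i (ltn_ord i); case: ltnP => /= [_|? _ _]; last by lia.
    by move=> + /negbT; rewrite -leqNgt; lia.
  have := @sum_count_disjoint _ P k (unzip2 s)
    (fun i j li lj ne => proj1 (disj i j li lj ne)).
  rewrite big_split => cnt /leq_trans => /(_ _ (leq_add cnt ch)).
  rewrite size_map; lia.
move=> i /andP[ltP ltQ].
have [Pt Qt _ PQ] := HP i (ltn_ord i).
have [p pP ps] : exists2 p, p \in P i & p \notin unzip2 s by apply: count_lt_fresh; rewrite Pt.
have [q qQ qs] : exists2 q, q \in Q i & q \notin unzip1 s by apply: count_lt_fresh; rewrite Qt.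
have [[y x] /splitPr Es /= /andP[yQ xP]] := gate i (ltn_ord i).
have djP j : j < k -> j != i -> (p \in P j = false) * (q \in Q j = false).
  move=> jk ji; have [|d1 d2] := disj i j (ltn_ord i) jk; first by rewrite eq_sym.
  by rewrite (disjointFr d1 pP) (disjointFr d2 qQ).
case: Es sa sa' lt ws lu u1 u2 gate bal ltP ltQ ps qs => s1 s2.
rewrite /unzip1 /unzip2 !size_cat !map_cat !last_cat /= => sa sa' lt ws lu u1 u2 gate bal _ _ ps qs.
(* The edge y - x becomes y - p - q - x inside brick [i]; its part y - p serves as the next
   insertion place. *)
apply: (IH (s1 ++ (y, p) :: (q, x) :: s2)).
- by rewrite size_cat /=; clear -lt sa'; lia.
- by rewrite size_cat /=; clear -sa'; lia.
- move: ws; rewrite !walk_cat /= => /and4P[-> -> _ ->].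
  by rewrite !PQ.
- by rewrite /unzip2 map_cat last_cat.
- rewrite /unzip1 map_cat /= !uniq_insert; move: u1 qs; rewrite uniq_insert.
  rewrite !mem_cat !inE !negb_or eq_sym => /andP[/andP[-> ->] ->] /and3P[-> -> ->].
  by [].
- rewrite /unzip2 map_cat /= !uniq_insert; move: u2 ps; rewrite uniq_insert.
  rewrite !mem_cat !inE !negb_or => /andP[/andP[-> ->] ->] /and3P[-> -> ->].
  by [].
- move=> j jk; have [-> | ji] := eqVneq j i.
    by exists (y, p); rewrite /= ?yQ ?pP // mem_cat mem_head orbT.
  have [z zs zPQ] := gate j jk; exists z => //.
  move: zs; rewrite !mem_cat !inE => /or3P[->//|/eqP zE|->]; last by rewrite !orbT.
  have [|d1 _] := disj i j (ltn_ord i) jk; first by rewrite eq_sym.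
  by move: zPQ; rewrite zE /= (disjointFr d1 xP) andbF.
- move=> j jk; have := bal j jk; rewrite /unzip1 /unzip2 !map_cat !count_cat /=.
  have [-> | ji] := eqVneq j i; first by rewrite pP qQ; clear; lia.
  by have [-> ->] := djP j jk ji.
Qed.

End Bricks.

(** * Stringing the bricks on a short cycle *)

Section Threading.
Variables (X Y : finType) (r : X -> Y -> bool) (X0 : {set X}) (d w L : nat).
Implicit Types bs : seq (X * Y * X).

(* A triple (p, q, p') stands for the path p - q - p' inside a brick. *)
Definition ends bs : seq X := flatten [seq [:: b.1.1; b.2] | b <- bs].
Definition mids bs : seq Y := [seq b.1.2 | b <- bs].

Lemma size_ends bs : size (ends bs) = 2 * size bs.
Proof. by elim: bs => //= b bs; rewrite /ends /= => ->; lia. Qed.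

Lemma card_setU_seq (T : finType) (A : {set T}) (s : seq T) :
  #|A :|: [set x in s]| <= #|A| + size s.
Proof.
have [+ _] := leq_card_setU A [set x in s].
by move/leq_trans; apply; rewrite leq_add2l cardsE card_size.
Qed.

(** Induction along [bs]: connect [u] to the first brick, cross it, and continue from its second
    end. The allowance L + 3 per connection leaves room for the vertices used and those reserved. *)
Lemma thread_bricks bs u v (WX : {set X}) (WY : {set Y}) :
  linked r X0 d w L ->
  {in bs, forall b, r b.1.1 b.1.2 && r b.2 b.1.2} ->
  uniq (u :: v :: ends bs) -> uniq (mids bs) ->
  {in u :: v :: ends bs, forall x, [&& x \in X0, 2 * d <= rdeg r x & x \notin WX]} ->
  {in mids bs, forall y, y \notin WY} ->
  #|WX| + (size bs).+1 * (L + 3) <= w -> #|WY| + (size bs).+1 * (L + 3) <= w ->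
  exists s, [/\ walk r u s, last u (unzip2 s) = v, uniq (unzip1 s),
     uniq (u :: unzip2 s) & [/\ {in unzip2 s, forall x, x \notin WX},
     {in unzip1 s, forall y, y \notin WY}, size s <= (size bs).+1 * L.+1
     & {in bs, forall b, (b.1.2, b.2) \in s}]].
Proof.
move=> lk; elim: bs u WX WY => [|[[p q] p'] bs IH] u WX WY rb.
  move=> /= /andP[uv _] _ good _ WXw WYw.
  have /and3P[uX du uW] := good u (mem_head _ _).
  have /and3P[vX dv vW] : [&& v \in X0, 2 * d <= rdeg r v & v \notin WX].
    by apply: good; rewrite !inE eqxx orbT.
  have [|||||s [? ? ? ? [? ? sL]]] := lk WX WY u v _ _ _ _ _ du dv.
  - by clear -WXw; lia.
  - by clear -WYw; lia.
  - by rewrite inE uW.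
  - by rewrite inE vW.
  - by move: uv; rewrite inE.
  exists s; split => //; split => //; clear -sL; lia.
rewrite /ends /mids /= -/(ends bs) -/(mids bs) => un /andP[qbs umid] good midW WXw WYw.
have /and3P[uX du uW] := good u (mem_head _ _).
have /and3P[pX dp pW] : [&& p \in X0, 2 * d <= rdeg r p & p \notin WX].
  by apply: good; rewrite !inE eqxx !orbT.
have /andP[/= rpq rp'q] := rb (p, q, p') (mem_head _ _).
have qW : q \notin WY by apply: midW; rewrite mem_head.
have {}un : uniq (u :: p :: p' :: v :: ends bs).
  rewrite -(perm_uniq (_ : perm_eq (u :: v :: p :: p' :: ends bs) _)) //.
  by rewrite perm_cons; exact: (permEl (perm_catCA [:: v] [:: p; p'] _)).
(* [V1] and [V2] keep the first connection away from vertices needed later. *)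
pose V1 := WX :|: [set x in p' :: v :: ends bs].
pose V2 := WY :|: [set y in q :: mids bs].
have [|||||s1 [w1 l1 uy1 ux1 [sV1 sV2 s1L]]] := lk V1 V2 u p _ _ _ _ _ du dp.
- by apply: leq_trans (card_setU_seq _ _) _; rewrite /= size_ends; clear -WXw; move: WXw => /=; lia.
- by apply: leq_trans (card_setU_seq _ _) _; rewrite /= size_map; clear -WYw; move: WYw => /=; lia.
- rewrite in_setD uX andbT in_setU negb_or uW inE.
  by move: un => /=; rewrite inE negb_or => /andP[/andP[]].
- rewrite in_setD pX andbT in_setU negb_or pW inE.
  by move: un => /= /and3P[_ ->].
- by move: un => /=; rewrite inE negb_or => /andP[/andP[]].
(* [U1] and [U2] forbid the vertices already used to the rest of the walk. *)
pose U1 := WX :|: [set x in u :: unzip2 s1].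
pose U2 := WY :|: [set y in q :: unzip1 s1].
have [|||||||s2 [w2 l2 uy2 ux2 [sU1 sU2 s2L s2b]]] := IH p' U1 U2.
- by move=> b bb; apply: rb; rewrite inE bb orbT.
- by move: un => /= /and3P[].
- done.
- move=> x xin.
  have /and3P[-> -> xW] : [&& x \in X0, 2 * d <= rdeg r x & x \notin WX].
    apply: good; rewrite !inE; move: xin; rewrite !inE.
    by case/or3P=> ->; rewrite ?orbT.
  rewrite /= in_setU negb_or xW inE inE negb_or /=; apply/andP; split.
    by move: un xin => /= /andP[+ _] xin; rewrite inE negb_or => /andP[_]; apply: contraNN => /eqP <-.
  apply/negP => /sV1; by rewrite in_setU inE xin orbT.
- move=> y yin; rewrite in_setU negb_or midW ?inE ?yin ?orbT //= negb_or.
  apply/andP; split; first by apply: contraNN qbs => /eqP <-.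
  by apply/negP => /sV2; rewrite !inE yin !orbT.
- have := card_setU_seq WX (u :: unzip2 s1); rewrite -/U1 /= size_map.
  by clear -WXw s1L; move: WXw => /=; lia.
- have := card_setU_seq WY (q :: unzip1 s1); rewrite -/U2 /= size_map.
  by clear -WYw s1L; move: WYw => /=; lia.
exists (s1 ++ (q, p') :: s2); rewrite /unzip1 /unzip2 !map_cat /= last_cat /=.
split => //; first by rewrite walk_cat /= w1 l1 rpq rp'q w2.
- rewrite cat_uniq uy1 /= uy2 andbT negb_or -andbA; apply/and3P; split.
  + by apply/negP => /sV2; rewrite !inE eqxx orbT.
  + by apply/hasPn => y /sU2; rewrite !inE !negb_or => /and3P[].
  + by apply/negP => /sU2; rewrite !inE eqxx orbT.
- suff: uniq ((u :: unzip2 s1) ++ p' :: unzip2 s2) by [].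
  rewrite cat_uniq ux1 ux2 andbT /= negb_or; apply/andP; split.
    rewrite inE negb_or; apply/andP; split.
      by apply/eqP => E; move: un; rewrite E /= !inE eqxx orbT.
    by apply/negP => /sV1; rewrite !inE eqxx orbT.
  by apply/hasPn => x /sU1; rewrite !inE !negb_or => /andP[].
split.
- move=> x; rewrite mem_cat inE => /or3P[/sV1|/eqP->|/sU1].
  + by rewrite in_setU negb_or => /andP[].
  + by have /and3P[] : [&& p' \in X0, 2 * d <= rdeg r p' & p' \notin WX]
      by apply: good; rewrite !inE eqxx !orbT.
  + by rewrite in_setU negb_or => /andP[].
- move=> y; rewrite mem_cat inE => /or3P[/sV2|/eqP->//|/sU2].
  + by rewrite in_setU negb_or => /andP[].
  + by rewrite in_setU negb_or => /andP[].
- by rewrite size_cat /=; clear -s1L s2L; lia.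
- move=> b; rewrite inE => /predU1P[->|/s2b bs2]; first by rewrite mem_cat mem_head orbT.
  by rewrite mem_cat inE bs2 !orbT.
Qed.

(** A short cycle with an edge inside every brick is built first, and [grow_cycle] then brings it to
    the exact length. *)
Lemma linked_acycle t k sz a b :
  linked r X0 d w L -> 0 < b -> 0 < k -> 1 < t ->
  t * #|Y| + sz * (t * 2 ^ sz) < sz * (2 * d) ->
  k * t + sz + b <= #|X0| -> k * t + 4 * d + b <= #|Y| ->
  k * (L + 3) + 1 <= w -> w <= a -> a + w <= k * t ->
  acycle r a \/ acycle (fun x y => ~~ r x y) b.
Proof.
move=> lk b0 k0 t1 num HX HY kw wa akt.
have HY' : k * t + 2 * (2 * d) + b <= #|Y| by lia.
have [|[P [Q pk]]] := packing_or_acycle r b0 num HX HY'; first by right.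
left.
have [HP disj] := pk.
have [Pt0 Qt0 _ _] := HP 0 k0.
have [x0 _] : exists x, x \in P 0 by apply/card_gt0P; rewrite Pt0; lia.
have [y0 _] : exists y, y \in Q 0 by apply/card_gt0P; rewrite Qt0; lia.
pose p i := nth x0 (enum (P i)) 0.
pose p' i := nth x0 (enum (P i)) 1.
pose q i := nth y0 (enum (Q i)) 0.
have Hpq i : i < k -> [/\ p i \in P i, p' i \in P i, q i \in Q i & p i != p' i].
  move=> ik; have [Pt Qt _ _] := HP i ik; split.
  - by rewrite -mem_enum mem_nth // -cardE Pt; lia.
  - by rewrite -mem_enum mem_nth // -cardE Pt; lia.
  - by rewrite -mem_enum mem_nth // -cardE Qt; lia.
  - by rewrite nth_uniq ?enum_uniq // -cardE Pt; lia.
have apart i j (ij : i != j) : i < k -> j < k ->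
    (forall x, x \in P i -> x \notin P j) /\ (forall y, y \in Q i -> y \notin Q j).
  move=> ik jk; have [d1 d2] := disj i j ik jk ij.
  by split=> z zi; [rewrite (disjointFr d1 zi)|rewrite (disjointFr d2 zi)].
pose B (I : seq nat) := [seq (p i, q i, p' i) | i <- I].
have endsP (I : seq nat) x : all (fun i => i < k) I -> x \in ends (B I) ->
    exists2 i, i \in I & x \in P i.
  move=> /allP Ik /flatten_mapP[b' /mapP[i iI ->]] /= xi; exists i => //.
  have [p1 p2 _ _] := Hpq i (Ik i iI).
  by move: xi; rewrite !inE => /orP[]/eqP ->.
have uniq_ends (I : seq nat) : uniq I -> all (fun i => i < k) I -> uniq (ends (B I)).
  elim: I => // i I IH /= /andP[iI uI] /andP[ik Ik].
  have [p1 p2 _ pp] := Hpq i ik.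
  have far x : x \in P i -> x \notin ends (B I).
    move=> xi; apply/negP => /(endsP _ _ Ik)[j jI xj].
    have ij : i != j by apply: contraNneq iI => ->.
    have jk : j < k by move/allP: Ik; apply.
    by have [/(_ x xi)] := apart i j ij ik jk; rewrite xj.
  by rewrite /ends /= -/(ends _) inE negb_or pp !far // IH.
have qinj i j : i < k -> j < k -> q i = q j -> i = j.
  move=> ik jk E; apply/eqP; apply: contraT => ij.
  have [_ /(_ (q i))] := apart i j ij ik jk.
  have [_ _ qi _] := Hpq i ik; have [_ _ qj _] := Hpq j jk.
  by rewrite qi {1}E qj => /(_ isT).
pose J := iota 1 k.-1.
have J0 : iota 0 k = 0 :: J by rewrite /J -[in LHS](prednK k0).
have Jk : all (fun i => i < k) (0 :: J).
  by rewrite -J0; apply/allP => i; rewrite mem_iota.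
have JkP i : i \in J -> i < k /\ i != 0.
  move=> iJ; split; first by move/allP: Jk; apply; rewrite inE iJ orbT.
  by move: iJ; rewrite mem_iota; lia.
have [p0 p'0 q0 _] := Hpq 0 k0.
have rP i x y : i < k -> x \in P i -> y \in Q i -> r x y.
  by move=> ik; have [_ _ _] := HP i ik; apply.
(* Brick 0 closes the cycle: the walk runs from [p' 0] to [p 0] through all other bricks, avoiding
   [q 0], and returns to [p' 0] by way of [q 0]. *)
have [|||||||s [ws ls us1 us2 [_ sq sL sJ]]] :=
    @thread_bricks (B J) (p' 0) (p 0) set0 [set q 0] lk.
- move=> b' /mapP[i /JkP[ik _] ->] /=; have [p1 p2 q1 _] := Hpq i ik.
  by rewrite !(rP i).
- have := uniq_ends (0 :: J); rewrite -{1}J0 iota_uniq => /(_ isT Jk).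
  rewrite /ends /= -/(ends _) !inE !negb_or eq_sym.
  by case/and3P => /andP[-> ->] -> ->.
- rewrite /mids -map_comp map_inj_in_uniq ?iota_uniq // => i j /JkP[ik _] /JkP[jk _].
  exact: qinj.
- move=> x xin; suff [i ik xi] : exists2 i, i < k & x \in P i.
    have [_ _ /subsetP/(_ x xi)] := HP i ik.
    by rewrite !inE andbT.
  move: xin; rewrite !inE => /or3P[/eqP->|/eqP->|].
  + by exists 0.
  + by exists 0.
  + case/endsP; first by case/andP: Jk.
    by move=> i /JkP[ik _] xi; exists i.
- move=> y /mapP[b' /mapP[i /JkP[ik i0] ->] ->] /=; rewrite inE.
  by apply: contraNneq i0 => /(qinj _ _ ik k0) ->.
- by rewrite cards0 size_map size_iota prednK //; clear -kw; lia.
- by rewrite cards1 size_map size_iota prednK //; clear -kw; lia.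
have szB : (size (B J)).+1 = k by rewrite size_map size_iota prednK.
rewrite szB in sL.
pose s' := rcons s (q 0, p' 0).
(* Taking all vertices of [Q i] on the short cycle as slack makes the balance immediate; by
   disjointness the slacks sum to at most the size of [s']. *)
pose c i := count (mem (Q i)) (unzip1 s').
have s's : size s' <= w by rewrite size_rcons; clear -sL kw k0; nia.
apply: (@grow_cycle _ _ r _ _ _ _ _ c w a pk _ akt (p' 0) s').
- apply: leq_trans s's; rewrite -(size_map fst s').
  by apply: sum_count_disjoint => i j ik jk ij; have [] := disj i j ik jk ij.
- exact: leq_trans s's wa.
- by rewrite /s' -cats1 walk_cat ws ls /= !(rP 0).
- by rewrite /s' /unzip2 map_rcons last_rcons.
- rewrite /s' /unzip1 map_rcons rcons_uniq us1 andbT.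
  by apply/negP => /sq; rewrite inE eqxx.
- by rewrite /s' /unzip2 map_rcons rcons_uniq.
- move=> [|i] ik.
    by exists (q 0, p' 0); rewrite ?mem_rcons ?mem_head //= q0.
  have [p1 p2 q1 _] := Hpq _ ik.
  exists (q i.+1, p' i.+1); last by rewrite /= q1.
  rewrite /s' mem_rcons inE; apply/orP; right.
  apply: (sJ (p i.+1, q i.+1, p' i.+1)); apply: map_f; rewrite mem_iota.
  by clear -ik; lia.
- by move=> i ik; rewrite /c leq_addl.
Qed.

End Threading.

(** * Two cuts *)

Section Cuts.
Variables (X Y : finType).
Implicit Types (r : X -> Y -> bool).

Lemma complete_acycle r (A : {set X}) (B : {set Y}) m : 0 < m ->
  m <= #|A| -> m <= #|B| -> {in A & B, forall x y, r x y} -> acycle r m.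
Proof.
move=> m0 mA mB AB; apply: (rich_acycle m0 mA) => x x' xA x'A.
apply: leq_trans mB _; apply: subset_leq_card; apply/subsetP => y yB.
by rewrite inE !AB.
Qed.

(** If [x] had small degree in [r1], its degree in [r2] would be large, so the cut would apply to
    it. All vertices across the cut would then be neighbours in [r1], which are too many. *)
Lemma cut_high_rdeg r1 r2 d w (WX : {set X}) (WY : {set Y})
    (sigma : X -> bool) (tau : Y -> bool) x :
  (forall x y, r1 x y || r2 x y) -> 2 * d <= #|Y| -> w <= d ->
  (forall x y, x \notin WX -> d <= rdeg r2 x -> y \notin WY -> r2 x y ->
        sigma x = tau y) ->
  (forall c, 2 * d <= #|[set y | tau y == c] :\: WY| + w) ->
  x \notin WX -> d <= rdeg r1 x.
Proof.
move=> r12 dY wd cutr big xW; rewrite leqNgt; apply/negP => d1.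
have d2 : d <= rdeg r2 x.
  have [+ _] := leq_card_setU [set y | r1 x y] [set y | r2 x y].
  have -> : [set y | r1 x y] :|: [set y | r2 x y] = setT.
    by apply/setP => y; rewrite !inE r12.
  by rewrite cardsT -!/(rdeg _ _); lia.
have : #|[set y | tau y == ~~ sigma x] :\: WY| <= rdeg r1 x.
  apply: subset_leq_card; apply/subsetP => y; rewrite !inE => /andP[yW /eqP ty].
  have := r12 x y; case: (boolP (r2 x y)) => [r2xy _|_]; last by rewrite orbF.
  by move: ty; rewrite -(cutr x y) //; case: (sigma x).
by have := big (~~ sigma x); lia.
Qed.

(** By [cut_high_rdeg] the degree conditions hold off the exceptional sets, so there every pair
    agrees in the cut of its own color. *)
Lemma cuts_resolve r d w L a b :
  0 < d -> 2 * w <= d -> 2 * d <= #|Y| -> 0 < L -> 0 < a -> 0 < b ->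
  a + b + 2 * w <= #|X| -> a + b + 2 * w <= #|Y| ->
  cut r d w -> cut (fun x y => ~~ r x y) d w ->
  [\/ acycle r a, acycle (fun x y => ~~ r x y) b |
      exists2 X0 : {set X}, #|X| <= #|X0| + 2 * w & linked r X0 d w L].
Proof.
move=> d0 wd dY L0 a0 b0 HX HY.
case=> W1 [V1 [s1 [t1 [W1w V1w cut1 big1]]]].
case=> W2 [V2 [s2 [t2 [W2w V2w cut2 big2]]]].
have wd' : w <= d by lia.
pose X0 := ~: (W1 :|: W2); pose Y0 := ~: (V1 :|: V2).
have X0c : #|X| <= #|X0| + 2 * w.
  by have [+ _] := leq_card_setU W1 W2; have := cardsC (W1 :|: W2); rewrite -/X0; lia.
have Y0c : #|Y| <= #|Y0| + 2 * w.
  by have [+ _] := leq_card_setU V1 V2; have := cardsC (V1 :|: V2); rewrite -/Y0; lia.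
have red x y : x \in X0 -> y \in Y0 -> r x y -> s1 x = t1 y.
  rewrite !inE !negb_or => /andP[x1 x2] /andP[y1 y2]; apply: cut1 => //.
  by apply: (cut_high_rdeg _ dY wd' cut2 big2 x2) => ? ?; rewrite orbN.
have blue x y : x \in X0 -> y \in Y0 -> ~~ r x y -> s2 x = t2 y.
  rewrite !inE !negb_or => /andP[x1 x2] /andP[y1 y2]; apply: cut2 => //.
  by apply: (cut_high_rdeg _ dY wd' cut1 big1 x1) => ? ?; rewrite orNb.
have pick1 c (F : {set Y}) : #|F| <= 2 * w ->
    exists2 y, t1 y = c & (y \notin V1) && (y \notin F).
  move=> Fw; have [|y] := @fresh_elt _ ([set y | t1 y == c] :\: V1) (enum F).
    by rewrite -cardE; have := big1 c; lia.
  rewrite mem_enum !inE => /andP[yV /eqP ty] yF.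
  by exists y; rewrite ?yV.
have pick2 c (F : {set Y}) : #|F| <= 2 * w ->
    exists2 y, t2 y = c & (y \notin V2) && (y \notin F).
  move=> Fw; have [|y] := @fresh_elt _ ([set y | t2 y == c] :\: V2) (enum F).
    by rewrite -cardE; have := big2 c; lia.
  rewrite mem_enum !inE => /andP[yV /eqP ty] yF.
  by exists y; rewrite ?yV.
have fit x y : x \in X0 -> y \in Y0 -> (s1 x == t1 y) || (s2 x == t2 y).
  move=> xX yY; case: (boolP (r x y)) => [/(red x y xX yY)|/(blue x y xX yY)] ->.
    by rewrite eqxx.
  by rewrite eqxx orbT.
(* A vertex of Y opposite to [x] in one cut is on its side in the other, and must also agree with
   [x'] in some cut. Testing both cuts shows that [s1] and [s2] change together. *)
have parity x x' : x \in X0 -> x' \in X0 -> s1 x (+) s2 x = s1 x' (+) s2 x'.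
  move=> xX x'X; have [|y1 ty1 /andP[y1V1 y1V2]] := pick1 (~~ s1 x) V2; first by lia.
  have [|y2 ty2 /andP[y2V2 y2V1]] := pick2 (~~ s2 x) V1; first by lia.
  have y1Y : y1 \in Y0 by rewrite !inE negb_or y1V1.
  have y2Y : y2 \in Y0 by rewrite !inE negb_or y2V1.
  move: (fit x y1 xX y1Y) (fit x' y1 x'X y1Y) (fit x y2 xX y2Y) (fit x' y2 x'X y2Y).
  rewrite ty1 ty2.
  by case: (s1 x); case: (s2 x); case: (s1 x'); case: (s2 x');
    case: (t1 y2); case: (t2 y1).
have [/existsP[x1 /existsP[x2 /and3P[x1X x2X x12]]]|const] :=
    boolP [exists x1, exists x2, [&& x1 \in X0, x2 \in X0 & s1 x1 != s1 x2]]; last first.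
  apply: Or33; exists X0 => //.
  have {}const x x' : x \in X0 -> x' \in X0 -> s1 x = s1 x' /\ s2 x = s2 x'.
    move=> xX x'X; have e : s1 x = s1 x'.
      apply: contraNeq const => ne; apply/existsP; exists x; apply/existsP; exists x'.
      by rewrite xX x'X.
    by split=> //; have := parity x x' xX x'X; rewrite e => /addbI.
  move=> WX WY u v WXw WYw; rewrite !in_setD => /andP[uW uX] /andP[vW vX] uv _ _.
  (* Such a [y] lies across the blue cut from all of [X0], so it is red to all of [X0] and links [u]
     to [v] in one step. *)
  have [|y ty /andP[yV2 yF]] := pick2 (~~ s2 u) (V1 :|: WY).
    by have [+ _] := leq_card_setU V1 WY; lia.
  have {yF} [yV1 yW] : y \notin V1 /\ y \notin WY by move: yF; rewrite !inE negb_or => /andP[].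
  have yY : y \in Y0 by rewrite !inE negb_or yV1.
  have yr x : x \in X0 -> r x y.
    move=> xX; apply: contraT => /(blue x y xX yY); rewrite ty.
    by have [_ ->] := const x u xX uX; case: (s2 u).
  exists [:: (y, v)]; split=> //=; first by rewrite !yr.
    by rewrite inE uv.
  by split=> // z; rewrite inE => /eqP ->.
have red_iff x y : x \in X0 -> y \in Y0 -> r x y = (s1 x == t1 y).
  move=> xX yY; case: (boolP (r x y)) => [/(red x y xX yY) ->|/(blue x y xX yY) E].
    by rewrite eqxx.
  apply/esym/negP => /eqP E1.
  (* By parity [x'] differs from [x] in both cuts, so a [y] agreeing with [x] in both would agree
     with [x'] in neither. *)
  have [x' x'X ne] : exists2 x', x' \in X0 & s1 x' = ~~ s1 x.
    have [e|n] := eqVneq (s1 x1) (s1 x).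
      by exists x2 => //; move: x12; rewrite e; case: (s1 x); case: (s1 x2).
    by exists x1 => //; move: n; case: (s1 x); case: (s1 x1).
  have := parity x x' xX x'X; have := fit x' y x'X yY; rewrite ne -E -E1.
  by case: (s1 x); case: (s2 x); case: (s2 x').
pose A c := [set x in X0 | s1 x == c]; pose B c := [set y in Y0 | t1 y == c].
have cardA : #|X0| = #|A true| + #|A false|.
  rewrite -(cardsID [set x | s1 x]) -!setIdE; congr (_ + _); apply: eq_card => x.
    by rewrite !inE eqb_id.
  by rewrite !inE eqbF_neg andbC.
have cardB : #|Y0| = #|B true| + #|B false|.
  rewrite -(cardsID [set y | t1 y]) -!setIdE; congr (_ + _); apply: eq_card => x.
    by rewrite !inE eqb_id.
  by rewrite !inE eqbF_neg andbC.
have redAB c : a <= #|A c| -> a <= #|B c| -> acycle r a.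
  move=> Ac Bc; apply: (complete_acycle a0 Ac Bc) => x y.
  rewrite in_set => /andP[xX /eqP sx]; rewrite in_set => /andP[yY /eqP ty].
  by rewrite red_iff // sx ty.
have blueAB c : b <= #|A c| -> b <= #|B (~~ c)| -> acycle (fun x y => ~~ r x y) b.
  move=> Ac Bc; apply: (complete_acycle b0 Ac Bc) => x y.
  rewrite in_set => /andP[xX /eqP sx]; rewrite in_set => /andP[yY /eqP ty].
  by rewrite red_iff // sx ty; case: (c).
have [/andP[]|n1] := boolP ((a <= #|A true|) && (a <= #|B true|)).
  by move=> ? ?; apply: Or31; exact: (redAB true).
have [/andP[]|n2] := boolP ((a <= #|A false|) && (a <= #|B false|)).
  by move=> ? ?; apply: Or31; exact: (redAB false).
have [/andP[]|n3] := boolP ((b <= #|A true|) && (b <= #|B false|)).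
  by move=> ? ?; apply: Or32; exact: (blueAB true).
have [/andP[]|n4] := boolP ((b <= #|A false|) && (b <= #|B true|)).
  by move=> ? ?; apply: Or32; exact: (blueAB false).
(* As [X0] and [Y0] have at least a + b vertices each, the four blocks cannot all be too small. *)
clear -HX HY X0c Y0c cardA cardB n1 n2 n3 n4; lia.
Qed.

Lemma two_color_acycle_nat r K d w t sz ka kb a b :
  0 < d -> 0 < a -> 0 < b -> 1 < t -> 0 < ka -> 0 < kb -> #|X| = #|Y| ->
  2 * w <= d -> w <= a -> w <= b ->
  #|Y| <= K * d -> 0 < K ->
  t * #|Y| + sz * (t * 2 ^ sz) < sz * (2 * d) ->
  ka * t + sz + b + 2 * w <= #|Y| -> ka * t + 4 * d + b <= #|Y| ->
  kb * t + sz + a + 2 * w <= #|Y| -> kb * t + 4 * d + a <= #|Y| ->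
  ka * (4 * K + 3) + 1 <= w -> kb * (4 * K + 3) + 1 <= w ->
  a + w <= ka * t -> b + w <= kb * t -> a + b + 2 * w <= #|Y| ->
  acycle r a \/ acycle (fun x y => ~~ r x y) b.
Proof.
move=> d0 a0 b0 t1 ka0 kb0 XY wd wa wb YK K0 num A1 A2 B1 B2 kaw kbw ak bk ab.
(* Stated for a subset because it serves twice: for all of X, and for the set left by
   [cuts_resolve]. *)
have red (X0 : {set X}) : #|X| <= #|X0| + 2 * w -> linked r X0 d w (4 * K) ->
    acycle r a \/ acycle (fun x y => ~~ r x y) b.
  move=> X0c lk; apply: (linked_acycle lk b0 ka0 t1 num) => //.
  by clear -X0c A1 XY; lia.
(* The length 4K suffices since |Y| <= K d and d - w >= d / 2. *)
have num2 : 2 * #|Y| < (4 * K).+1 * (d - w) by clear -YK wd d0 K0; nia.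
have [cutr|] := linked_or_cut r num2; last by apply: red; rewrite cardsT; lia.
have [cutb|lk] := linked_or_cut (fun x y => ~~ r x y) num2; last first.
  have [||] := linked_acycle lk a0 kb0 t1 num _ B2 kbw wb bk.
  - by rewrite cardsT; clear -B1 XY; lia.
  - by right.
  - left; have -> // : r = (fun x y => ~~ ~~ r x y).
    by apply/funext => x; apply/funext => y; rewrite negbK.
have dY : 2 * d <= #|Y| by clear -A2; lia.
have L0 : 0 < 4 * K by clear -K0; lia.
have abX : a + b + 2 * w <= #|X| by rewrite XY.
case: (cuts_resolve d0 wd dY L0 a0 b0 abX ab cutr cutb) => [|| [X0 X0c lk]].
- by left.
- by right.
- exact: red lk.
Qed.

End Cuts.

(** * Choice of the constants *)

Lemma two_color_acycle K : exists d0,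
  forall (X Y : finType) (r : X -> Y -> bool) d a b,
  d0 <= d -> d <= a -> d <= b -> #|X| = #|Y| -> a + b + 7 * d <= #|Y| ->
  #|Y| <= K * d -> acycle r a \/ acycle (fun x y => ~~ r x y) b.
Proof.
(* t makes the at most K d / t + 1 connecting paths, of length at most 4 K, use
   fewer than d / 2 vertices; sz is the number of vertices of degree 2 d that
   guarantees a brick. *)
pose t := 16 * K * (K + 1) + 2; pose sz := t * K + 1.
exists (t * 2 ^ sz + t * (4 * K + 5) + sz + 2) => X Y r d a b dd da db XY abd YK.
have szK : sz = t * K + 1 by [].
have tK : t = 16 * K * (K + 1) + 2 by [].
clearbody sz t; move: dd; set e := t * 2 ^ sz => dd.
have d0 : 0 < d by lia.
have K0 : 0 < K by case: (K) YK => // /leq_trans => /(_ 0); lia.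
have t1 : 1 < t by lia.
pose w := d./2.
have w2 : 2 * w <= d /\ d <= 2 * w + 1 by rewrite /w; lia.
clearbody w; case: w2 => wd dw.
have kP c : c <= #|Y| -> exists k,
    [/\ 0 < k, c <= k * t, k * t <= c + t & k * (4 * K + 3) + 1 <= w].
  move=> cY; exists (c %/ t).+1; have := leq_divM c t; have := ltn_ceil c (ltnW t1).
  set k := c %/ t => H1 H2; split; [by []|by apply: ltnW|by rewrite mulSn; lia|].
  clearbody k.
  (* The bound on the number of bricks is checked after multiplication by [t]: here k t <= K d,
     while t w is about 8 K (K + 1) d. *)
  have H3 : t * (k.+1 * (4 * K + 3) + 1) <= (K * d + t) * (4 * K + 3) + t.
    have : k * t <= K * d by lia.
    by clear; nia.
  have H4 : t * (4 * K + 5) <= d by lia.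
  rewrite -(leq_pmul2l (ltnW t1)); apply: leq_trans H3 _.
  have E1 : t * d = 16 * (K * (K * d)) + 16 * (K * d) + 2 * d by rewrite tK; clear; lia.
  have E2 : t * d <= 2 * (t * w) + t.
    by apply: leq_trans (leq_mul (leqnn t) dw) _; clear; lia.
  clear -E1 E2 H4; nia.
have [ka [ka0 kat tka kaw]] := kP (a + w) ltac:(lia).
have [kb [kb0 kbt tkb kbw]] := kP (b + w) ltac:(lia).
apply: (@two_color_acycle_nat X Y r K d w t sz ka kb a b) => //;
  try by clear -kat tka kbt tkb abd wd da db dd; lia.
(* The first summand is at most (sz - 1) d as sz = t K + 1, the second at most sz d as t 2^sz <=
   d. *)
rewrite -/e; have F1 : t * #|Y| <= t * (K * d) by rewrite leq_mul2l YK orbT.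
have F2 : sz * e <= sz * d by rewrite leq_mul2l; apply/orP; right; clear -dd; lia.
have F3 : sz * d = t * (K * d) + d by rewrite szK; clear; lia.
clear -F1 F2 F3 d0; lia.
Qed.

(** * Back to graphs *)

Lemma Kbip_is_edge N (x y : 'I_N) : @is_edge (Kbip N N) [set inl x; inr y].
Proof.
by apply/existsP; exists (inl x); apply/existsP; exists (inr y); rewrite eqxx.
Qed.

Definition Kbip_edge N (x y : 'I_N) : edge (Kbip N N) :=
  exist (fun e : {set Kbip N N} => is_edge e) _ (Kbip_is_edge x y).

Lemma walk_nth (X Y : finType) (r : X -> Y -> bool) x0 y0 u s i :
  walk r u s -> (i < size s)%N ->
  r (nth x0 (u :: unzip2 s) i) (nth y0 (unzip1 s) i) /\
  r (nth x0 (unzip2 s) i) (nth y0 (unzip1 s) i).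
Proof.
elim: s u i => // [[y x] s] IH u [|i] /= /and3P[ru rx ws] si //.
exact: IH ws si.
Qed.

(** The embeddings [fx] and [fy] allow the cycle to be found in a smaller complete bipartite
    subgraph. *)
Lemma acycle_mono_copy N (c : edge_coloring (Kbip N N)) k (X Y : finType)
    (r : X -> Y -> bool) (fx : X -> 'I_N) (fy : Y -> 'I_N) m :
  injective fx -> injective fy ->
  (forall x y, r x y -> c (Kbip_edge (fx x) (fy y)) = k) ->
  (0 < m)%N -> acycle r m -> mono_copy c k (cycle_graph (2 * m)).
Proof.
move=> fxI fyI rk m0 [u [s [ws ls u1 u2 sm]]].
have [y0 _] : exists y0, y0 \in unzip1 s.
  by case: s sm {ws ls u1 u2} => [|z s] /= sm; [rewrite -sm in m0|exists z.1; rewrite mem_head].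
have sx : size (unzip2 s) = m by rewrite size_map.
have sy : size (unzip1 s) = m by rewrite size_map.
pose gx i := nth u (unzip2 s) i; pose gy i := nth y0 (unzip1 s) i.
(* even positions carry the Y-vertices of the closed walk, odd ones its X-vertices *)
pose f (i : 'I_(2 * m)) : Kbip N N :=
  if odd i then inl (fx (gx i./2)) else inr (fy (gy i./2)).
have hlt (i : 'I_(2 * m)) : (i./2 < m)%N by have := ltn_ord i; lia.
have step (i : 'I_(2 * m)) : exists x y, r x y /\ [set f i; f (ordS i)] = [set inl (fx x); inr (fy y)].
  have si : (i./2 < size s)%N by rewrite sm.
  have [_ rxy] := walk_nth u y0 ws si.
  have := ltn_ord i; rewrite /f /=; case: (boolP (odd i)) => oi lti.
    have [lt|ge] := ltnP i.+1 (2 * m).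
      rewrite modn_small //= oi /= uphalf_half oi.
      exists (gx i./2), (gy i./2.+1); split => //.
      have si' : (i./2.+1 < size s)%N by rewrite sm; lia.
      by have [+ _] := walk_nth u y0 ws si'.
    (* The successor wraps around to 0. The last X-vertex of the walk is [u], so its first step
       supplies this edge. *)
    have -> : (i.+1 = 2 * m)%N by lia.
    rewrite modnn /=; exists (gx i./2), (gy 0%N); split => //.
    have s0 : (0 < size s)%N by rewrite sm.
    have [+ _] := walk_nth u y0 ws s0; rewrite /=.
    have -> : i./2 = m.-1 by lia.
    by rewrite /gx -sx nth_last ls.
  rewrite modn_small; last by lia.
  rewrite /= oi /= uphalf_half (negbTE oi) add0n.
  by exists (gx i./2), (gy i./2); rewrite setUC.
exists f; split.
  move=> i j; rewrite /f; case: (boolP (odd i)) => oi; case: (boolP (odd j)) => oj // [].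
    move/fxI/eqP; rewrite nth_uniq ?sx ?hlt // => /eqP e.
    by apply: val_inj; rewrite /= -[LHS]odd_double_half -[RHS]odd_double_half oi oj e.
  move/fyI/eqP; rewrite nth_uniq ?sy ?hlt // => /eqP e.
  by apply: val_inj; rewrite /= -[LHS]odd_double_half -[RHS]odd_double_half (negbTE oi) (negbTE oj) e.
move=> i j /andP[_ /orP[/eqP ->|/eqP ->]].
  have [x [y [/rk ck ->]]] := step i; by exists (Kbip_edge (fx x) (fy y)).
have [x [y [/rk ck e]]] := step j; exists (Kbip_edge (fx x) (fy y)).
by rewrite setUC e.
Qed.

(** * From real parameters to integers *)

Import Order.TTheory GRing.Theory Num.Theory.
Local Open Scope ring_scope.

Theorem theorem1p1 (R : realType) (xi alpha1 alpha2 : R)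
    (xi_gt0 : 0 < xi) (alpha1_gt0 : 0 < alpha1) (alpha2_gt0 : 0 < alpha2) :
  exists n0 : nat, forall n : nat, (n0 <= n)%N ->
    forall N : nat, (alpha1 + alpha2 + 8 * xi) * n%:R <= N%:R ->
      forall c : edge_coloring (Kbip N N),
        mono_copy c color1 (cycle_graph (2 * Num.truncn (alpha1 * n%:R))) \/
        mono_copy c color2 (cycle_graph (2 * Num.truncn (alpha2 * n%:R))).
Proof.
pose T := alpha1 + alpha2 + 8 * xi.
pose g := Num.min xi (Num.min alpha1 alpha2).
have g0 : 0 < g by rewrite !lt_min xi_gt0 alpha1_gt0.
have [gx [ga1 ga2]] : g <= xi /\ g <= alpha1 /\ g <= alpha2.
  by rewrite !ge_min !lexx !orbT.
have T0 : 0 < T by rewrite /T; lra.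
(* With N0 <= T n and d >= g n - 1 >= g n / 2, the ratio N0 / d is at most 2 T / g. *)
pose K := (Num.truncn (2 * T / g)).+1.
have [d0 H] := two_color_acycle K.
(* This makes g n >= d0 + 2, hence both d >= d0 and g n >= 2. *)
exists (Num.truncn ((d0 + 2)%:R / g)).+1 => n nn N NT c.
have n0 : 0 <= n%:R :> R by [].
have gn : (d0 + 2)%:R <= g * n%:R.
  rewrite mulrC -ler_pdivrMr //; apply: ltW; apply: lt_le_trans (truncnS_gt _) _.
  by rewrite ler_nat.
(* As [N] may be arbitrarily large compared with [n], only [N0] vertices of each side are kept, so
   that their number is at most K d. *)
pose d := Num.truncn (g * n%:R); pose N0 := Num.truncn (T * n%:R).
have gn0 : 0 <= g * n%:R by apply: mulr_ge0 => //; exact: ltW.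
have mono (x y : R) : x <= y -> (Num.truncn (x * n%:R) <= Num.truncn (y * n%:R))%N.
  by move=> xy; apply: le_truncn; rewrite ler_wpM2r.
have dd0 : (d0 + 2 <= d)%N by rewrite truncn_ge_nat.
have d_gt0 : (0 < d)%N by apply: leq_trans dd0; rewrite addnS.
have N0N : (N0 <= N)%N.
  by rewrite -(@natrK R N) le_truncn.
set a := Num.truncn (alpha1 * n%:R); set b := Num.truncn (alpha2 * n%:R).
have da : (d <= a)%N by apply: mono.
have db : (d <= b)%N by apply: mono.
have abN : (a + b + 7 * d <= N0)%N.
  rewrite truncn_ge_nat; last by apply: mulr_ge0 => //; exact: ltW.
  have ta : a%:R <= alpha1 * n%:R by rewrite truncn_le mulr_ge0 // ltW.
  have tb : b%:R <= alpha2 * n%:R by rewrite truncn_le mulr_ge0 // ltW.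
  have td : d%:R <= xi * n%:R.
    by apply: (@le_trans _ _ (g * n%:R)); rewrite ?truncn_le // ler_wpM2r.
  have xn : 0 <= xi * n%:R by rewrite mulr_ge0 // ltW.
  by rewrite natrD natrD natrM /T; lra.
have NK : (N0 <= K * d)%N.
  have Kg : 2 * T <= K%:R * g by rewrite -ler_pdivrMr // ltW // truncnS_gt.
  have tN : N0%:R <= T * n%:R by rewrite truncn_le mulr_ge0 // ltW.
  have td : g * n%:R <= d%:R + 1 by rewrite natr1 ltW // truncnS_gt.
  have g2 : 2 <= g * n%:R by apply: le_trans gn; rewrite ler_nat leq_addl.
  have K0 : 0 <= K%:R :> R by [].
  rewrite -(ler_nat R) natrM; apply: le_trans tN _.
  have := ler_wpM2r n0 Kg; have := ler_wpM2l K0 td; have := ler_wpM2l K0 g2.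
  by lra.
pose w := widen_ord N0N.
pose r (x y : 'I_N0) := if c (Kbip_edge (w x) (w y)) is color1 then true else false.
have wI : injective w by move=> x y /(congr1 val) /= e; apply: val_inj.
have [||||cyc|cyc] := H _ _ r d a b _ da db; rewrite ?card_ord //.
- exact: leq_trans (leq_addr _ _) dd0.
- left; apply: (acycle_mono_copy wI wI _ _ cyc).
    by move=> x y; rewrite /r; case: (c _).
  exact: leq_trans da.
- right; apply: (acycle_mono_copy wI wI _ _ cyc).
    by move=> x y; rewrite /r; case: (c _).
  exact: leq_trans db.
Qed.
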